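(* For all $0<p\le q$, the Assouad dimension of $S_{p,q}$ satisfies $\dim_{\mathrm{A}} S_{p,q} = 2$.
   Context: For $0<p\le q$, the elliptical polynomial spiral is $S_{p,q} = \{ t^{-p}\cos t + i\, t^{-q}\sin t : 1 < t < \infty\} \subset \mathbb{C} \cong \mathbb{R}^2$. The Assouad dimension of $F\subset\mathbb{R}^n$ is $$\dim_{\mathrm{A}} F = \inf\{\alpha\ge 0 : \exists\, C>0 \text{ such that for all } 0<r<R \text{ and } x\in F,\ N_r(B(x,R)\cap F)\le C(R/r)^\alpha\},$$ where $N_r(E)$ is the smallest number of hypercubes of sidelength $r$ required to cover $E$ and $B(x,R)$ is the ball with centre $x$ and radius $R$. *)

(* Defs.v *)
From mathcomp Require Import all_boot all_order all_algebra.
From mathcomp Require Import all_classical all_reals all_analysis.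
From mathcomp Require Import complex.

Set Implicit Arguments.
Unset Strict Implicit.
Unset Printing Implicit Defensive.

Import Order.TTheory GRing.Theory Num.Theory.

Local Open Scope classical_set_scope.
Local Open Scope ring_scope.

(* The library norm on row vectors is the maximum norm, so Euclidean balls have
   to be defined explicitly. *)
Definition enorm (R : realType) (n : nat) (x : 'rV[R]_n) : R :=
  Num.sqrt (\sum_(i < n) x 0 i ^+ 2).

Definition eball (R : realType) (n : nat) (x : 'rV[R]_n) (rho : R) :
    set 'rV[R]_n :=
  [set y | enorm (y - x) <= rho].

(* Closed, axis-parallel, with lowest corner [a]. *)
Definition hypercube (R : realType) (n : nat) (a : 'rV[R]_n) (r : R) :
    set 'rV[R]_n :=
  [set y | forall i : 'I_n, a 0 i <= y 0 i <= a 0 i + r].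

(* An infimum of natural numbers, hence attained when [E] has a finite cover;
   it is [+oo] when there is none. *)
Definition covering_number (R : realType) (n : nat) (r : R)
    (E : set 'rV[R]_n) : \bar R :=
  ereal_inf [set k%:R%:E | k in [set k : nat |
    exists a : 'I_k -> 'rV[R]_n,
      E `<=` \bigcup_(j in [set: 'I_k]) hypercube (a j) r]].

Definition assouad_dim (R : realType) (n : nat) (F : set 'rV[R]_n) : \bar R :=
  ereal_inf [set alpha%:E | alpha in [set alpha : R | 0 <= alpha /\
    exists C : R, 0 < C /\
      forall (r rho : R) (x : 'rV[R]_n), 0 < r -> r < rho -> F x ->
        (covering_number r (eball x rho `&` F)
           <= (C * (rho / r) `^ alpha)%:E)%E]].

Definition elliptical_spiral (R : realType) (p q : R) : set R[i] :=
  [set (t `^ (- p) * cos t +i* (t `^ (- q) * sin t))%C | t in [set t : R | 1 < t]].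

Definition complex_to_plane (R : realType) (z : R[i]) : 'rV[R]_2 :=
  \row_(i < 2) (if i == 0 then complex.Re z else complex.Im z).

(* Main.v *)
(* Fix N and look at the turns t in [2 pi j + pi / 2, 2 pi j + pi] for
   N^2 <= j < N^2 + N, near the vertical axis.  There the curve is so close to
   horizontal that, with A = 4 pi N^2 and r of order A^(-q-1), consecutive turns
   keep a vertical distance larger than r over a horizontal range of length 2rN;
   by the intermediate value theorem each of them meets the vertical lines
   x = -2ri, 0 <= i < N.  This gives N^2 points, pairwise more than r apart in
   the maximum norm, in one ball of radius O(Nr), and hence the lower bound 2 on
   the dimension as N tends to infinity. *)
Require Import Defs.
From mathcomp Require Import all_boot all_order all_algebra.
From mathcomp Require Import all_classical all_reals all_analysis.
From mathcomp Require Import complex.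
From mathcomp Require Import ring lra.

Import Order.TTheory GRing.Theory Num.Theory.
Import numFieldNormedType.Exports.

Local Open Scope classical_set_scope.
Local Open Scope ring_scope.

(** * Norm comparison and covering numbers *)

Lemma normr_le_enorm (R : realType) (n : nat) (x : 'rV[R]_n) (i : 'I_n) :
  `|x 0 i| <= enorm x.
Proof.
rewrite -sqrtr_sqr ler_wsqrtr// (bigD1 i)//= lerDl.
by apply: sumr_ge0 => j _; exact: sqr_ge0.
Qed.

Lemma enorm_le_sum (R : realType) (n : nat) (x : 'rV[R]_n) :
  enorm x <= \sum_(i < n) `|x 0 i|.
Proof.
suff [s0 s2] : 0 <= \sum_(i < n) `|x 0 i| /\
    \sum_(i < n) x 0 i ^+ 2 <= (\sum_(i < n) `|x 0 i|) ^+ 2.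
  by rewrite -[leRHS]ger0_norm// -sqrtr_sqr ler_wsqrtr.
elim/big_rec2: _ => [|i u v _ [u0 vu]]; first by rewrite expr0n.
split; first by rewrite addr_ge0.
rewrite -[x 0 i ^+ 2]real_normK ?num_real//.
have := normr_ge0 (x 0 i); nra.
Qed.

Lemma covering_number_le (R : realType) (n : nat) (T : finType) (r : R)
    (E : set 'rV[R]_n) (a : T -> 'rV[R]_n) :
  (forall y, E y -> exists u, hypercube (a u) r y) ->
  (covering_number r E <= #|T|%:R%:E)%E.
Proof.
move=> Ea; apply: ereal_inf_lbound; exists #|T| => //.
exists (fun j => a (enum_val j)) => y /Ea[u yu].
by exists (enum_rank u) => //=; rewrite enum_rankK.
Qed.

(* A cube of side [r] contains at most one of the points [f u]. *)
Lemma le_covering_number (R : realType) (n : nat) (T : finType) (r : R)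
    (E : set 'rV[R]_n) (f : T -> 'rV[R]_n) :
  (forall u, E (f u)) ->
  (forall u v, u != v -> exists i, r < `|f u 0 i - f v 0 i|) ->
  (#|T|%:R%:E <= covering_number r E)%E.
Proof.
move=> Ef sep; apply: le_ereal_inf_tmp => _ [k [a Ea] <-].
rewrite lee_fin ler_nat.
have /choice[g gP] u : exists j, hypercube (a j) r (f u).
  by have [j _ fj] := Ea _ (Ef u); exists j.
rewrite -[k]card_ord; apply: (@leq_card _ _ g) => u v guv.
apply/eqP; apply: contraT => uv; case: (sep _ _ uv) => i.
rewrite ltNge => /negP[].
have := gP v i; have := gP u i; rewrite guv => /andP[h1 h2] /andP[h3 h4].
by rewrite ler_norml; apply/andP; split; lra.
Qed.

(** The ball lies in the cube of side [2 * rho] centred at [x], which is cut into grid cells of side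
    [r] with [m] cells per axis. Since [rho / r > 1], the rounding in [m] is absorbed by passing
    from factor 2 to factor 3. *)
Lemma covering_number_eball_le (R : realType) (n : nat) (r rho : R)
    (x : 'rV[R]_n) (F : set 'rV[R]_n) : 0 < r -> r < rho ->
  (covering_number r (eball x rho `&` F) <= ((3 * (rho / r)) ^+ n)%:E)%E.
Proof.
move=> r0 rrho; set m := (Num.truncn (2 * (rho / r))).+1.
have rr1 : 1 < rho / r by rewrite ltr_pdivlMr// mul1r.
apply: (@le_trans _ _ #|{ffun 'I_n -> 'I_m}|%:R%:E).
  apply: (@covering_number_le _ _ _ _ _ (fun u : {ffun 'I_n -> 'I_m} =>
      \row_i (x 0 i - rho + (u i)%:R * r))) => y [xy _].
  have xyi i : 0 <= (y 0 i - x 0 i + rho) / r <= 2 * (rho / r).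
    have := le_trans (normr_le_enorm _ _ (y - x) i) xy.
    rewrite !mxE ler_norml => /andP[h1 h2].
    rewrite divr_ge0 ?(ltW r0)//=; last by lra.
    by rewrite mulrA ler_pM2r ?invr_gt0//; lra.
  have mi (i : 'I_n) : (Num.truncn ((y 0 i - x 0 i + rho) / r)%R < m)%N.
    by rewrite ltnS; apply: le_truncn; have /andP[] := xyi i.
  exists [ffun i => Ordinal (mi i)] => i; rewrite !mxE ffunE /=.
  have /andP[/truncn_itv/andP[h1 h2] _] := xyi i.
  move: h1 h2; rewrite -natr1 ler_pdivlMr// ltr_pdivrMr// [(_ + 1) * r]mulrDl mul1r.
  by move=> h1 h2; apply/andP; split; lra.
rewrite lee_fin card_ffun !card_ord natrX lerXn2r ?nnegrE//; first by lra.
rewrite /m -natr1.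
have : (Num.truncn (2 * (rho / r)))%:R <= 2 * (rho / r).
  by rewrite truncn_le; lra.
by lra.
Qed.

(** * Upper and lower bounds for the Assouad dimension *)

Lemma assouad_dim_le (R : realType) (n : nat) (F : set 'rV[R]_n) :
  (assouad_dim F <= n%:R%:E)%E.
Proof.
apply: ereal_inf_lbound; exists n%:R => //; split => //.
exists (3 ^+ n); split; first by rewrite exprn_gt0.
move=> r rho x r0 rrho _; have rho0 := lt_trans r0 rrho.
rewrite powR_mulrn ?divr_ge0 ?(ltW r0) ?(ltW rho0)// -exprMn.
exact: covering_number_eball_le.
Qed.

(** If some [alpha < d] were admissible with constant [C], the scale ratio [M * N] would give
    [N ^ d <= C * (M * N) ^ alpha], so [N ^ (d - alpha)] would stay below [C * M ^ alpha] for every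
    [N]. The bound [1 < M] makes the ball radius exceed [r]. *)
Lemma le_assouad_dim (R : realType) (n d : nat) (F : set 'rV[R]_n) (M : R) :
  1 < M ->
  (forall N : nat, (0 < N)%N -> exists r x, [/\ 0 < r, F x &
    ((N ^ d)%:R%:E <= covering_number r (eball x (M * N%:R * r) `&` F))%E]) ->
  (d%:R%:E <= assouad_dim F)%E.
Proof.
move=> M1 grid; apply: le_ereal_inf_tmp => _ [alpha [alpha0 [C [C0 FC]]] <-].
rewrite lee_fin leNgt; apply/negP => alphad.
have M0 : 0 < M by lra.
have b0 : 0 < d%:R - alpha by rewrite subr_gt0.
(* The successor makes [N] strictly larger than the root of [K] of order [d - alpha]. *)
set K := C * M `^ alpha; set N := (Num.truncn (K `^ (d%:R - alpha)^-1)).+1.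
have [r [x [r0 Fx NF]]] := grid N isT.
have N1 : 1 <= N%:R :> R by rewrite ler1n.
have rM : r < M * N%:R * r.
  by rewrite ltr_pMl// (lt_le_trans M1)// ler_peMr// ltW.
have := le_trans NF (FC _ _ _ r0 rM Fx).
rewrite mulfK ?gt_eqF// lee_fin natrX powRM ?(ltW M0)// mulrA -/K.
rewrite -powR_mulrn// leNgt => /negP; apply.
rewrite -[X in X%:R `^ d%:R]/N -[d%:R](subrK alpha).
rewrite powRD; last by rewrite (gt_eqF (lt_le_trans ltr01 N1)) implybT.
rewrite ltr_pM2r ?powR_gt0 ?(lt_le_trans ltr01 N1)//.
have K0 : 0 <= K by rewrite mulr_ge0 ?powR_ge0// ltW.
have -> : K = (K `^ (d%:R - alpha)^-1) `^ (d%:R - alpha).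
  by rewrite -powRrM mulVf ?powRr1// lt0r_neq0.
rewrite gt0_ltr_powR// ?nnegrE ?powR_ge0//.
exact: truncnS_gt.
Qed.

(** * Two-sided estimates for decrements of a negative power *)

(** After factoring out [a ^ (- q)], it remains to bound [(1 + 1/a) ^ q] below by [1 + q / (a + 1)].
    This follows from [ln (1 + 1/a) >= 1 / (a + 1)] and [exp y >= 1 + y]. *)
Lemma powRN_sub_ge (R : realType) (a q : R) : 0 < a -> 0 < q ->
  a `^ (- q) * (q / (a + 1 + q)) <= a `^ (- q) - (a + 1) `^ (- q).
Proof.
move=> a0 q0.
have -> : a + 1 = a * (1 + a^-1) by rewrite mulrDr mulr1 divff ?gt_eqF.
have a10 : 0 < a^-1 by rewrite invr_gt0.
rewrite powRM ?(ltW a0)//; last by lra.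
rewrite -{2}[a `^ _]mulr1 -mulrBr ler_pM2l ?powR_gt0//.
rewrite /powR gt_eqF; last by lra.
set L := ln _.
have L1 : q / (a + 1) <= q * L.
  have u0 : 0 < 1 + a^-1 by lra.
  have uV0 : 0 < (1 + a^-1)^-1 by rewrite invr_gt0.
  (* The upper bound [ln (1 + y) <= y], applied to the reciprocal, yields the lower bound on [L]. *)
  have : ln (1 + ((1 + a^-1)^-1 - 1)) <= (1 + a^-1)^-1 - 1.
    by apply: le_ln1Dx; lra.
  rewrite addrC subrK lnV ?posrE// -/L.
  have -> : (1 + a^-1)^-1 - 1 = - (a + 1)^-1.
    by field; rewrite !gt_eqF//; lra.
  rewrite lerN2.
  by rewrite ler_pM2l.
rewrite mulNr expRN.
have := expR_ge1Dx (q * L) => eL.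
have e1 : (a + 1 + q) / (a + 1) <= expR (q * L).
  by rewrite mulrDl divff ?gt_eqF//; lra.
have : (expR (q * L))^-1 <= (a + 1) / (a + 1 + q).
  rewrite -[leRHS]invrK invf_div lef_pV2 ?posrE ?expR_gt0 ?divr_gt0//; lra.
have -> : a * (1 + a^-1) = a + 1 by rewrite mulrDr mulr1 divff ?gt_eqF.
suff -> : q / (a + 1 + q) = 1 - (a + 1) / (a + 1 + q) by lra.
by field; rewrite gt_eqF//; lra.
Qed.

Lemma powRN_sub_le (R : realType) (a h q : R) : 0 < a -> 0 <= h -> 0 < q ->
  a `^ (- q) - (a + h) `^ (- q) <= a `^ (- q) * (q * h / a).
Proof.
move=> a0 h0 q0.
have -> : a + h = a * (1 + h / a) by rewrite mulrDr mulr1 mulrC divfK ?gt_eqF.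
have ha0 : 0 <= h / a by rewrite divr_ge0 // ltW.
rewrite powRM ?(ltW a0)//; last by lra.
rewrite -{1}[a `^ _]mulr1 -mulrBr ler_pM2l ?powR_gt0//.
rewrite /powR gt_eqF; last by lra.
have := expR_ge1Dx (- q * ln (1 + h / a)).
have : q * ln (1 + h / a) <= q * (h / a).
  by rewrite ler_pM2l// le_ln1Dx//; lra.
by lra.
Qed.

(** * A single turn of the spiral *)

Lemma sin_cosD2pin (R : realType) (x : R) (k : nat) :
  sin (pi *+ 2 *+ k + x) = sin x /\ cos (pi *+ 2 *+ k + x) = cos x.
Proof.
by rewrite addrC (periodicn (@sinD2pi R)) (periodicn (@cosD2pi R)).
Qed.

(** Along this quarter turn the abscissa moves continuously from 0 to [- (T + pi) ^ (- p)], so the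
    intermediate value theorem applies; the sine is nonnegative in the second quadrant. *)
Lemma spiral_crossing (R : realType) (p w : R) (k : nat) :
  0 <= w -> w <= (pi *+ 2 *+ k + pi) `^ (- p) ->
  exists t, [/\ pi *+ 2 *+ k + pi / 2 <= t <= pi *+ 2 *+ k + pi,
    t `^ (- p) * cos t = - w & 0 <= sin t].
Proof.
set T := pi *+ 2 *+ k => w0 wT; have pi0 := pi_gt0 R.
have T0 : 0 <= T by apply: mulrn_wge0; apply: mulrn_wge0; apply: pi_ge0.
have [sc cc] := sin_cosD2pin R (pi / 2) k.
have [sp cp] := sin_cosD2pin R pi k.
have [|||t tin tw] := @IVT R (fun t => t `^ (- p) * cos t) (T + pi / 2)
   (T + pi) (- w).
- by lra.
- apply: continuous_in_subspaceT => t; rewrite inE/= in_itv/= => /andP[h1 h2].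
  have t0 : 0 < t by lra.
  apply: (@cvgM R R); last exact: continuous_cos.
  have : {for t, continuous (fun u : R => u `^ (- p))}.
    apply: differentiable_continuous; apply/derivable1_diffP.
    by apply: derivable_powR; rewrite in_itv/= t0.
  exact.
- rewrite cc cp cos_pihalf cospi mulr0 mulrN1 ge_min le_max.

  by apply/andP; split; apply/orP; [right|left]; lra.
move: tin; rewrite in_itv/= => tin; exists t; split => //.
have -> : t = T + (t - T) by rewrite addrC subrK.
by rewrite (sin_cosD2pin _ _ _).1; apply: sin_ge0_pi; lra.
Qed.

Lemma ler_powRN (R : realType) (q x y : R) : 0 <= q -> 0 < x -> x <= y ->
  y `^ (- q) <= x `^ (- q).
Proof.
move=> q0 x0 xy; have y0 := lt_le_trans x0 xy.
rewrite !powRN lef_pV2 ?posrE ?powR_gt0//.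
by apply: ge0_ler_powR; rewrite ?nnegrE// ltW.
Qed.

(** Near the vertical axis the cosine is small: its modulus is at most [v * A ^ p], so its square is
    at most [eps]. Then [sin t >= sin t ^ 2 >= 1 - eps], and the height is almost [t ^ (- q)]. *)
Lemma spiral_height (R : realType) (p q a b A v eps t : R) :
  0 < p -> 0 < q -> 0 < b -> b <= t -> t <= a -> t <= A -> 0 <= sin t ->
  `|t `^ (- p) * cos t| <= v -> (v * A `^ p) ^+ 2 <= eps -> eps <= 1 ->
  a `^ (- q) * (1 - eps) <= t `^ (- q) * sin t <= b `^ (- q).
Proof.
move=> p0 q0 b0 bt ta tA st cv ve eps1.
have t0 : 0 < t by lra.
apply/andP; split; last first.
  apply: le_trans _ (ler_powRN _ _ _ _ (ltW q0) b0 bt).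
  by apply: ler_piMr; [exact: powR_ge0|exact: sin_le1].
apply: ler_pM; rewrite ?powR_ge0//; first lra.
  exact: ler_powRN (ltW q0) _ ta.
have tp : t `^ p <= A `^ p.
  by apply: ge0_ler_powR; rewrite ?nnegrE; lra.
have cvA : `|cos t| <= v * A `^ p.
  have -> : cos t = (t `^ (- p) * cos t) * t `^ p.
    by rewrite mulrAC powRN mulVf ?mul1r// gt_eqF// powR_gt0.
  rewrite normrM (ger0_norm (powR_ge0 _ _)).
  by apply: ler_pM; rewrite ?powR_ge0.
have c2 : cos t ^+ 2 <= eps.
  rewrite -real_normK ?num_real//; apply: le_trans ve.
  by rewrite lerXn2r ?nnegrE ?(le_trans _ cvA).
have := cos2Dsin2 t; have := sin_le1 t; nra.
Qed.

(** * Construction of the separated grid of points *)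

Lemma spiral_grid (R : realType) (p q : R) (N : nat) :
  0 < p -> p <= q -> (0 < N)%N ->
  exists r x, [/\ 0 < r, (@complex_to_plane R @` elliptical_spiral p q) x &
    ((N ^ 2)%:R%:E <= covering_number r
      (eball x ((3 + 2 `^ q * (12 * pi * (2 + q) + 1)) * N%:R * r) `&`
       (@complex_to_plane R @` elliptical_spiral p q)))%E].
Proof.
move=> p0 pq N0; have q0 : 0 < q by lra.
set F := _ @` _; set K := 3 + _.
have N1 : 1 <= N%:R :> R by rewrite ler1n.
have pi2 := pi_ge2 R.
(* [A] bounds every parameter in use, and all of them are at least [A / 2]. *)
pose A : R := 4 * pi * N%:R ^+ 2; pose kap : R := q / (2 + q).
have A8 : 8 * N%:R ^+ 2 <= A.
  rewrite /A ler_pM2r ?exprn_gt0 ?(lt_le_trans ltr01 N1)//; lra.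
have NN1 : 1 <= N%:R ^+ 2 :> R by rewrite expr_ge1// (le_trans ler01).
have A1 : 1 <= A by lra.
have A0 : 0 < A by lra.
have kap0 : 0 < kap by rewrite divr_gt0//; lra.
have kap1 : kap <= 1 by rewrite ler_pdivrMr; lra.
(* Consecutive turns differ in height by a relative amount of at least [kap / A = 3 * eps]. One
   [eps] pays for the sine factor, and the other two leave room for the strict separation [r]. *)
pose eps := kap / (3 * A); pose r := A `^ (- q) * eps.
have eps0 : 0 < eps by rewrite divr_gt0//; lra.
have eps1 : eps <= 1 by rewrite ler_pdivrMr; lra.
have r0 : 0 < r by rewrite mulr_gt0 ?powR_gt0.
pose T (l : nat) : R := pi *+ 2 *+ (N ^ 2 + l).
have TE l : T l = 2 * pi * (N%:R ^+ 2 + l%:R).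
  by rewrite /T -[_ *+ (N ^ 2 + l)]mulr_natr natrD natrX -[pi *+ 2]mulr_natl.
have Tmono l l' : (l < l')%N -> T l + 2 * pi <= T l'.
  rewrite -(ler_nat R) !TE -natr1 => ll'.
  have : 2 * pi * (l%:R + 1) <= 2 * pi * l'%:R :> R by rewrite ler_pM2l//; lra.
  lra.
have TA (l : 'I_N) : T l + pi <= A.
  rewrite TE /A.
  have : l%:R + 1 <= N%:R :> R by rewrite natr1 ler_nat.
  have : N%:R <= N%:R ^+ 2 :> R by rewrite ler_eXnr.
  move=> h1 h2.
  have : pi * (l%:R + 1) <= pi * N%:R ^+ 2 :> R by rewrite ler_pM2l; lra.
  lra.
have T0 l : A / 2 <= T l.
  have : 0 <= pi * l%:R :> R by rewrite mulr_ge0 ?pi_ge0.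
  by rewrite TE /A; lra.
(* Here [p <= q] enters: a horizontal offset of order [A ^ (- q)] is small compared with the width
   [A ^ (- p)] of a turn. *)
have AqA : A `^ (- q) * A `^ p <= 1.
  rewrite -powRD; last by rewrite (gt_eqF A0) implybT.
  by rewrite -[leRHS](powRr0 A); apply: ler_powR => //; lra.
have epsA : 3 * eps * A = kap by rewrite /eps; field; rewrite gt_eqF.
have epsN : 4 * N%:R ^+ 2 * eps <= 2^-1.
  have : 8 * N%:R ^+ 2 * eps <= A * eps by rewrite ler_pM2r.
  lra.
have rE : r = A `^ (- q) * eps by [].
clearbody r eps.
have xbd (i : 'I_N) : 0 <= 2 * r * i%:R <= 2 * r * N%:R.
  apply/andP; split; first by rewrite !mulr_ge0// ltW.
  by rewrite ler_pM2l ?mulr_gt0// ler_nat ltnW.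
have rNA : 2 * r * N%:R * A `^ p <= 2 * N%:R * eps.
  have -> : 2 * r * N%:R * A `^ p = 2 * N%:R * eps * (A `^ (- q) * A `^ p).
    by rewrite rE; ring.
  by rewrite ler_piMr// !mulr_ge0// ltW.
(* This is the flatness condition of [spiral_height] with [v = 2 * r * N]. It holds because [eps] is
   of order [N ^ (-2)], so that [(2 * N * eps) ^ 2 <= eps]. *)
have rNA2 : (2 * r * N%:R * A `^ p) ^+ 2 <= eps.
  have : 0 <= 2 * r * N%:R * A `^ p by rewrite !mulr_ge0 ?powR_ge0// ltW.
  move=> h0; apply: (@le_trans _ _ ((2 * N%:R * eps) ^+ 2)).
    by rewrite lerXn2r// nnegrE (le_trans h0).
  have -> : (2 * N%:R * eps) ^+ 2 = 4 * N%:R ^+ 2 * eps * eps by ring.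
  by rewrite ler_piMl ?(ltW eps0)//; lra.
have cross (u : 'I_N * 'I_N) : exists t,
    [/\ T u.1 + pi / 2 <= t <= T u.1 + pi,
    t `^ (- p) * cos t = - (2 * r * u.2%:R) & 0 <= sin t].
  have /andP[x1 x2] := xbd u.2.
  apply: spiral_crossing => //; apply: le_trans x2 _.
  apply: (@le_trans _ _ (A `^ (- p))); last first.
    by apply: ler_powRN; [lra|have := T0 u.1; rewrite -/(T _); lra|exact: TA].
  rewrite powRN -[leRHS]mul1r ler_pdivlMr ?powR_gt0//.
  apply: le_trans rNA _.
  have : N%:R * eps <= N%:R ^+ 2 * eps by rewrite ler_pM2r// ler_eXnr.
  lra.
have {cross}[t tP] := choice cross.
pose P (s : R) := complex_to_plane
  (s `^ (- p) * cos s +i* (s `^ (- q) * sin s))%C.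
have PF s : 1 < s -> F (P s).
  move=> s1; exists (s `^ (- p) * cos s +i* (s `^ (- q) * sin s))%C => //.
  by exists s.
have P0 s : P s 0 0 = s `^ (- p) * cos s by rewrite mxE.
have P1 s : P s 0 1 = s `^ (- q) * sin s by rewrite mxE.
(* The centre of the ball is the point where the first turn crosses the positive vertical axis. *)
pose B := T 0%N + pi / 2.
have [sB cB] : sin B = 1 /\ cos B = 0.
  by rewrite -(sin_pihalf R) -(cos_pihalf R); exact: sin_cosD2pin.
have BA : A / 2 <= B by have := T0 0%N; rewrite /B; lra.
have PB0 : P B 0 0 = 0 by rewrite P0 cB mulr0.
have PB1 : P B 0 1 = B `^ (- q) by rewrite P1 sB mulr1.
have height (u : 'I_N * 'I_N) : (T u.1 + pi) `^ (- q) * (1 - eps) <= P (t u) 0 1 <=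
    (T u.1 + pi / 2) `^ (- q).
  have [/andP[t1 t2] ct st] := tP u; rewrite P1.
  apply: (@spiral_height _ p _ _ _ A (2 * r * N%:R)) => //.
  - by have := T0 u.1; lra.
  - by apply: le_trans t2 (TA _).
  - by rewrite ct normrN ger0_norm; have /andP[] := xbd u.2.
have t1 (u : 'I_N * 'I_N) : 1 < t u.
  by have [/andP[t1 _] _ _] := tP u; have := T0 u.1; lra.
have below (u v : 'I_N * 'I_N) : (u.1 < v.1)%N -> r < P (t u) 0 1 - P (t v) 0 1.
  move=> uv.
  have a0 : 0 < T u.1 + pi by have := T0 u.1; lra.
  (* The parameter gap between the two arcs is at least [3 * pi / 2]; keeping only 1 of it fits
     [powRN_sub_ge]. *)
  have h1 : (T v.1 + pi / 2) `^ (- q) <= (T u.1 + pi + 1) `^ (- q).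
    by apply: ler_powRN; [lra|lra|have := Tmono _ _ uv; lra].
  have h2 := powRN_sub_ge _ _ _ a0 q0.
  have h3 := ler_powRN _ _ _ _ (ltW q0) a0 (TA u.1).
  have h4 : 3 * eps <= q / (T u.1 + pi + 1 + q).
    rewrite ler_pdivlMr; last by lra.
    have h : T u.1 + pi + 1 + q <= (2 + q) * A.
      have := TA u.1; have : q * 1 <= q * A by rewrite ler_pM2l.
      lra.
    apply: (@le_trans _ _ (3 * eps * ((2 + q) * A))).
      by rewrite ler_pM2l//; lra.
    have -> : 3 * eps * ((2 + q) * A) = (2 + q) * (3 * eps * A) by ring.
    by rewrite epsA /kap mulrC divfK// gt_eqF//; lra.
  have /andP[h5 _] := height u; have /andP[_ h6] := height v.
  have : r < (T u.1 + pi) `^ (- q) * (q / (T u.1 + pi + 1 + q) - eps).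
    apply: (@lt_le_trans _ _ (A `^ (- q) * (2 * eps))).
      by rewrite rE ltr_pM2l ?powR_gt0//; lra.
    by apply: ler_pM; rewrite ?powR_ge0//; lra.
  lra.
exists r, (P B); split => //; first by apply: PF; lra.
rewrite -[X in (X ^ 2)%N]card_ord expnS expn1 -card_prod.
apply: (@le_covering_number _ _ _ _ _ (P \o t)) => [u|u v uv] /=.
  split; last exact: PF.
  apply: le_trans (enorm_le_sum _ _ _) _.
  rewrite big_ord_recl big_ord1.
  have -> : lift ord0 ord0 = 1 :> 'I_2 by apply/val_inj.
  have cd i : (P (t u) - P B) 0 i = P (t u) 0 i - P B 0 i by rewrite !mxE.
  rewrite !cd -[ord0]/(0 : 'I_2) PB0 PB1 subr0.
  have BE : B = 2 * pi * N%:R ^+ 2 + pi / 2 by rewrite /B TE addr0.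
  have B0 : 0 < B by lra.
  have Bq0 : 0 <= B `^ (- q) by exact: powR_ge0.
  have /andP[h1 h2] := height u.
  have h3 : P (t u) 0 1 <= B `^ (- q).
    apply: le_trans h2 _; apply: ler_powRN (ltW q0) B0 _.
    have : 0 <= pi * u.1%:R :> R by rewrite mulr_ge0 ?pi_ge0.
    by rewrite BE TE; lra.
  have hN : 0 <= 2 * pi * N%:R :> R by rewrite !mulr_ge0 ?pi_ge0.
  (* All arcs end within [N] full periods after [B], so the total drop in height is controlled by
     one application of [powRN_sub_le]. *)
  have h4 : (B + 2 * pi * N%:R) `^ (- q) <= (T u.1 + pi) `^ (- q).
    apply: ler_powRN; [lra|have := T0 u.1; lra|].
    have : pi * (u.1%:R + 1) <= pi * N%:R :> R.
      by rewrite ler_pM2l ?natr1 ?ler_nat ?pi_gt0.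
    by rewrite BE TE; lra.
  have h5 := powRN_sub_le _ _ _ _ B0 hN q0.
  (* The definition of [eps] rewrites [q] as a multiple of [eps * A], and [A / 2 <= B] cancels the
     factor [A]. *)
  have h6 : q * (2 * pi * N%:R) / B <= 12 * pi * (2 + q) * N%:R * eps.
    rewrite ler_pdivrMr//.
    have qE : q = (2 + q) * (3 * eps * A).
      by rewrite epsA /kap mulrC divfK// gt_eqF//; lra.
    have -> : q * (2 * pi * N%:R) = 12 * pi * (2 + q) * N%:R * eps * (A / 2).
      by rewrite [in LHS]qE; field.
    by rewrite ler_wpM2l// !mulr_ge0 ?pi_ge0//; lra.
  (* Replacing [B] by its lower bound [A / 2] produces the factor [2 ^ q] in the radius. *)
  have h7 : B `^ (- q) <= 2 `^ q * A `^ (- q).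
    have -> : 2 `^ q * A `^ (- q) = (A / 2) `^ (- q).
      rewrite powRM ?invr_ge0//; last lra.
      by rewrite mulrC -powR_inv1// -powRrM mulrNN mul1r.
    by apply: ler_powRN => //; lra.
  have h8 : B `^ (- q) - P (t u) 0 1 <=
      2 `^ q * (12 * pi * (2 + q) + 1) * N%:R * r.
    apply: (@le_trans _ _ (B `^ (- q) *
       (12 * pi * (2 + q) * N%:R * eps + N%:R * eps))).
      have : B `^ (- q) * (q * (2 * pi * N%:R) / B) <=
          B `^ (- q) * (12 * pi * (2 + q) * N%:R * eps) by rewrite ler_wpM2l.
      have : B `^ (- q) * eps <= B `^ (- q) * (N%:R * eps).
        by rewrite ler_wpM2l// ler_peMl// ltW.
      have : (B + 2 * pi * N%:R) `^ (- q) * (1 - eps) <=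
          (T u.1 + pi) `^ (- q) * (1 - eps) by rewrite ler_wpM2r//; lra.
      have : (B + 2 * pi * N%:R) `^ (- q) * eps <= B `^ (- q) * eps.
        by rewrite ler_pM2r//; apply: ler_powRN; lra.
      lra.
    have -> : 2 `^ q * (12 * pi * (2 + q) + 1) * N%:R * r =
      2 `^ q * A `^ (- q) * (12 * pi * (2 + q) * N%:R * eps + N%:R * eps).
      by rewrite rE; ring.
    by rewrite ler_wpM2r// addr_ge0// !mulr_ge0 ?pi_ge0//; lra.
  have [_ ct _] := tP u; have /andP[x0 x1] := xbd u.2.
  rewrite P0 ct normrN ger0_norm// distrC ger0_norm ?subr_ge0//.
  apply: le_trans (lerD x1 h8) _.
  have : 0 <= r * N%:R by rewrite mulr_ge0// ltW.
  rewrite /K; lra.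
(* Points on different turns are separated vertically; points on the same turn lie on vertical lines
   spaced by [2 * r]. *)
have [h|h|h] := ltngtP u.1 v.1.
- by exists 1; apply: lt_le_trans (ler_norm _); exact: below.
- by exists 1; rewrite distrC; apply: lt_le_trans (ler_norm _); exact: below.
exists 0; rewrite !P0.
have [_ -> _] := tP u; have [_ -> _] := tP v.
have ne : u.2 != v.2.
  apply: contraNneq uv => e; rewrite [u]surjective_pairing e (val_inj h).
  by rewrite -surjective_pairing.
have far (i j : 'I_N) : (i < j)%N -> r < 2 * r * j%:R - 2 * r * i%:R.
  rewrite -(ler_nat R) -natr1 => ij.
  have : 2 * r * (i%:R + 1) <= 2 * r * j%:R by rewrite ler_pM2l ?mulr_gt0.
  lra.
rewrite opprK addrC.
move: ne; rewrite -val_eqE neq_ltn => /orP[/far|/far] ?.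
  by apply: lt_le_trans (ler_norm _); lra.
by rewrite distrC; apply: lt_le_trans (ler_norm _); lra.
Qed.

Theorem corollary2p7 (R : realType) (p q : R) (hp : 0 < p) (hpq : p <= q) :
  assouad_dim (@complex_to_plane R @` elliptical_spiral p q) = 2%:E.
Proof.
apply/eqP; rewrite eq_le assouad_dim_le /=.
pose M : R := 3 + 2 `^ q * (12 * pi * (2 + q) + 1).
apply: (@le_assouad_dim _ _ 2 _ M) => [|N N0]; last exact: spiral_grid.
have : 0 <= 2 `^ q * (12 * pi * (2 + q) + 1).
  by rewrite mulr_ge0 ?powR_ge0// addr_ge0// !mulr_ge0 ?pi_ge0//; lra.
rewrite /M; lra.
Qed.
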